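(* For $r\in\{1,\infty\}$, the set $\mathrm{Gen}(\mathbb{G}_r(0))=\{x\in\mathbb{G}_r(0)\mid\overline{\langle x\rangle}=\mathbb{G}_r(0)\}$ is comeager in $\mathbb{G}_r(0)$, that is, $\mathbb{G}_r(0)$ is generically monothetic.
   Context: All groups are written additively. A value on a group $G$ is a function $p\colon G\to[0,\infty)$ with $p(x)=0\iff x=0$, $p(-x)=p(x)$, and $p(x+y)\le p(x)+p(y)$ for all $x,y\in G$. A value induces the metric $d_p(x,y)=p(x-y)$, and metric and topological notions for a valued group $(G,p)$ refer to $d_p$. Isometric group homomorphisms, embeddings and isomorphisms are group homomorphisms, embeddings and isomorphisms preserving the values. A valued Abelian group $(G,p)$ is of class $\mathcal{O}_0$ if $\lim_{n\to\infty}p(nx)/n=0$ for every $x\in G$. Let $\mathfrak{G}_\infty(0)$ be the class of all separable valued Abelian groups of class $\mathcal{O}_0$, and $\mathfrak{G}_1(0)$ the subclass of those $(G,p)$ with $p\le 1$. For $r\in\{1,\infty\}$, $\mathbb{G}_r(0)$ denotes the valued Abelian group which is unique, up to isometric group isomorphism, with the following properties (its existence and uniqueness is a theorem of Niemiec): (1) $\mathbb{G}_r(0)$ is complete and belongs to $\mathfrak{G}_r(0)$; (2) every finite valued group in $\mathfrak{G}_r(0)$ admits an isometric group embedding into $\mathbb{G}_r(0)$; (3) every isometric group homomorphism between two finite subgroups of $\mathbb{G}_r(0)$ extends to an isometric group homomorphism of $\mathbb{G}_r(0)$ onto itself; (4) the elements of finite order form a dense subgroup of $\mathbb{G}_r(0)$.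 Here $\langle x\rangle$ is the cyclic subgroup generated by $x$ and the bar denotes topological closure. *)

(* Defs.v *)
From HB Require Import structures.
From mathcomp Require Import all_boot all_order all_algebra.
From mathcomp Require Import all_classical all_reals all_analysis.

Set Implicit Arguments.
Unset Strict Implicit.
Unset Printing Implicit Defensive.

Import Order.TTheory GRing.Theory Num.Theory.
Import numFieldNormedType.Exports.

Local Open Scope classical_set_scope.
Local Open Scope ring_scope.

(* The library's normedZmodType does not fit here: its norm is homogeneous
   with respect to natural multiples, whereas a value is only subadditive. *)
HB.mixin Record Zmodule_isValued (R : realType) G & GRing.Zmodule G := {
  pvalue : G -> R;
  pvalue_ge0 : forall x, 0 <= pvalue x;
  pvalue_eq0 : forall x, pvalue x = 0 <-> x = 0;
  pvalueN : forall x, pvalue (- x) = pvalue x;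
  ler_pvalueD : forall x y, pvalue (x + y) <= pvalue x + pvalue y
}.

#[short(type="valuedZmodType")]
HB.structure Definition ValuedZmodule (R : realType) :=
  { G of GRing.Zmodule G & Zmodule_isValued R G }.

Section induced_metric.
Context (R : realType) (G : valuedZmodType R).

Definition value_dist (x y : G) : R := pvalue (x - y).

Fact value_distxx x : value_dist x x = 0.
Proof. by rewrite /value_dist subrr; apply/pvalue_eq0. Qed.

Fact value_dist_positivity x y : value_dist x y = 0 -> x = y.
Proof. by move=> /pvalue_eq0/eqP; rewrite subr_eq0 => /eqP. Qed.

Fact value_dist_sym x y : value_dist x y = value_dist y x.
Proof. by rewrite /value_dist -pvalueN opprB. Qed.

Fact value_dist_triangle y x z :
  value_dist x z <= value_dist x y + value_dist y z.
Proof. by rewrite /value_dist -[x - z](subrKA y) ler_pvalueD. Qed.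

(* All topological and uniform notions on G refer to value_dist. *)
HB.instance Definition _ := isMetric.Build R G value_distxx
  value_dist_positivity value_dist_sym value_dist_triangle.

End induced_metric.

Section topological_notions.
Context {T : topologicalType}.

Definition separable := exists2 A : set T, countable A & dense A.

Definition nowhere_dense (A : set T) := (closure A)° = set0.

Definition meager (A : set T) :=
  exists2 F : nat -> set T,
    (forall n, nowhere_dense (F n)) & A = \bigcup_n F n.

Definition comeager (A : set T) := meager (~` A).

End topological_notions.
Arguments separable : clear implicits.

(* The library's completeType also requires a distinguished point. *)
Definition complete (T : uniformType) :=
  forall F : set_system T, ProperFilter F -> cauchy F -> exists x : T, F --> x.

Section valued_groups.
Context {R : realType}.
Implicit Types (G : valuedZmodType R) (r : \bar R).

Definition class_O0 G :=
  forall x : G, (fun n : nat => pvalue (x *+ n) / n%:R : R) @ \oo --> (0 : R).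

(* The class 𝔊_r(0), for r = 1 or r = +oo. *)
Definition class_G0 r G :=
  [/\ separable G, class_O0 G & forall x : G, ((pvalue x)%:E <= r)%E].

Definition is_subgroup G (H : set G) :=
  H 0 /\ forall x y, H x -> H y -> H (x - y).

(* A homomorphism H -> K between subgroups is represented by a function on the
   whole group, whose values outside H are irrelevant. *)
Definition isometric_hom_on G (H K : set G) (f : G -> G) :=
  [/\ forall x, H x -> K (f x),
      forall x y, H x -> H y -> f (x + y) = f x + f y
    & forall x, H x -> pvalue (f x) = pvalue x].

(* The properties that characterize 𝔾_r(0) up to isometric isomorphism. *)
Record is_bbG0 r G : Prop := {
  bbG0_complete : complete G;
  bbG0_class : class_G0 r G;
  bbG0_universal : forall F : valuedZmodType R,
    finite_set [set: F] -> class_G0 r F ->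
    exists f : {additive F -> G},
      injective f /\ forall x, pvalue (f x) = pvalue x;
  bbG0_homogeneous : forall (H K : set G) (f : G -> G),
    is_subgroup H -> finite_set H -> is_subgroup K -> finite_set K ->
    isometric_hom_on H K f ->
    exists g : {additive G -> G},
      [/\ forall x, pvalue (g x) = pvalue x,
          forall y, exists x, g x = y
        & forall x, H x -> g x = f x];
  bbG0_torsion_dense :
    dense [set x : G | exists2 n : nat, (0 < n)%N & x *+ n = 0]
}.

Definition cyclic_subgroup G (x : G) : set G := range (fun k : int => x *~ k).

Definition Gen G : set G := [set x | closure (cyclic_subgroup x) = setT].

End valued_groups.
Arguments Gen {R} G.

(* Main.v *)
From HB Require Import structures.
Require Import Defs.
From mathcomp Require Import all_boot all_order all_algebra.
From mathcomp Require Import all_classical all_reals all_analysis.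
From mathcomp Require Import lra.

(** Let D be a countable dense subset of G.  Then Gen G is the intersection of
    the countably many open sets U(d, e) = {x | some multiple of x is e-close
    to d}, for d in D and e = 1/(j+1), so it suffices that each U(d, e) is
    dense ([dense_near_multiples]).

    Torsion elements are dense, so this reduces to the following
    ([torsion_approx]): for torsion elements a, b and delta > 0, some x within
    delta of a has b as an exact multiple.  Such an x is first built outside G.
    Let k be a large common multiple of the orders of a and b, and adjoin to
    the subgroup <a, b> an element c with k c = b, the steps along c having
    length delta.  As soon as delta k >= p(b), going from 0 to b through the
    multiples of c is no shortcut, so the value of <a, b> is preserved.  Then
    x = a + c is within delta of a, and k x = k a + k c = b.

    The extended group is generated by a and c; it is obtained as the quotient
    of Z^2 by the null subgroup of an explicit semivalue
    ([root_semivalue], [valued_quotient]).  It is finite since a and c are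
    torsion, and truncating the semivalue at 1 if r = 1 puts it in the class
    G_r(0).  Universality embeds it into G, and homogeneity moves the embedded
    copy of <a, b> back to <a, b> ([extend_isometry]), which carries x into G. *)

Set Implicit Arguments.
Unset Strict Implicit.
Unset Printing Implicit Defensive.

Import Order.TTheory GRing.Theory Num.Theory.
Import numFieldNormedType.Exports.

Local Open Scope classical_set_scope.
Local Open Scope ring_scope.

(** * Semivalues and their Hausdorff quotients *)

Section semivalues.
Context {R : realType}.

Record is_semivalue (B : zmodType) (q : B -> R) : Prop := {
  semivalue_ge0 : forall x, 0 <= q x;
  semivalue0 : q 0 = 0;
  semivalueN : forall x, q (- x) = q x;
  ler_semivalueD : forall x y, q (x + y) <= q x + q y
}.

Lemma pvalue0 (G : valuedZmodType R) : pvalue (0 : G) = 0 :> R.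
Proof. exact/pvalue_eq0. Qed.

Lemma pvalue_mulrz (G : valuedZmodType R) (x : G) (n : int) :
  pvalue (x *~ n) <= pvalue x * `|n%:~R| :> R.
Proof.
have Hnat (m : nat) : pvalue (x *+ m) <= pvalue x * m%:R :> R.
  elim: m => [|m IHm]; first by rewrite mulr0n pvalue0 mulr0.
  rewrite mulrSr (le_trans (ler_pvalueD _ _))// -natr1 mulrDr mulr1.
  exact: lerD.
case: n => m; first by rewrite normr_nat; exact: Hnat.
by rewrite NegzE mulrNz mulrNz pvalueN normrN normr_nat; exact: Hnat.
Qed.

Section null.
Variables (B : zmodType) (q : B -> R).
Hypothesis hq : is_semivalue q.

(** Triangle inequality: a semivalue is constant on the cosets of its null
    subgroup, hence descends to the quotient. *)
Lemma semivalue_congr x y : q (x - y) = 0 -> q x = q y.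
Proof.
move=> xy0; apply/eqP; rewrite eq_le; apply/andP; split.
  by rewrite -[x](subrK y) (le_trans (ler_semivalueD hq _ _))// xy0 add0r.
rewrite -[y](subrK x) (le_trans (ler_semivalueD hq _ _))//.
by rewrite -opprB (semivalueN hq) xy0 add0r.
Qed.

Definition null_pred : {pred B} := [pred x | q x == 0].

Lemma null_zmod_closed : zmod_closed null_pred.
Proof.
split=> [|x y]; rewrite !inE; first by rewrite (semivalue0 hq).
move=> /eqP x0 /eqP y0; apply/eqP/le_anti; rewrite (semivalue_ge0 hq) andbT.
by rewrite (le_trans (ler_semivalueD hq _ _))// (semivalueN hq) x0 y0 addr0.
Qed.

(** Turns the construction of a valued group into that of a semivalue on a
    free group, where it can be given by a formula. *)
Lemma valued_quotient : exists (F : valuedZmodType R) (pi : {additive B -> F}),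
  (forall z, exists x, pi x = z) /\ forall x, pvalue (pi x) = q x.
Proof.
pose I : zmodClosed B := HB.pack null_pred
  (GRing.isZmodClosed.Build B null_pred null_zmod_closed).
pose Q : zmodType := Quotient.quot I.
pose pi : {additive B -> Q} := \pi_(Quotient.quot I)%qT.
have surj z : pi (repr z) = z by exact: reprK.
have ker x : pi x = 0 <-> q x = 0.
  have := Quotient.idealrBE I x 0; rewrite subr0 /= inE => E.
  by split=> [x0|x0]; apply/eqP; [rewrite E|move: E; rewrite x0 eqxx => /esym];
     rewrite -/(pi x) -/(pi 0) raddf0 ?x0.
pose p (z : Q) : R := q (repr z).
have pE x : p (pi x) = q x.
  by apply/semivalue_congr/ker; rewrite raddfB surj subrr.
have p_ge0 z : 0 <= p z by exact: (semivalue_ge0 hq).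
have p_eq0 z : p z = 0 <-> z = 0 by have := ker (repr z); rewrite surj => -[].
have pN z : p (- z) = p z by rewrite -[z]surj -raddfN !pE (semivalueN hq).
have pD y z : p (y + z) <= p y + p z.
  by rewrite -[y]surj -[z]surj -raddfD !pE (ler_semivalueD hq).
pose F : valuedZmodType R := HB.pack Q (Zmodule_isValued.Build R Q
  (pvalue := p) p_ge0 p_eq0 pN pD).
by exists F, pi; split=> [z|x]; [exists (repr z)|exact: pE].
Qed.
End null.

Section marginal.
Variables (B J : zmodType) (w : B * J -> R).
Hypothesis hw : is_semivalue w.

(** The quotient semivalue of [w] along the projection [B * J -> B]. *)
Definition marginal (x : B) : R := inf (range (fun j => w (x, j))).

Lemma ge_marginal x j : marginal x <= w (x, j).
Proof.
by apply: ge_inf; [exists 0 => _ [i _ <-]; exact: (semivalue_ge0 hw)|exists j].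
Qed.

Lemma le_marginal x c : (forall j, c <= w (x, j)) -> c <= marginal x.
Proof. by move=> cw; apply: lb_le_inf; [exists (w (x, 0)), 0|move=> _ [j _ <-]]. Qed.

Lemma marginal_semivalue : is_semivalue marginal.
Proof.
have ge0 x : 0 <= marginal x.
  by apply: le_marginal => j; exact: (semivalue_ge0 hw).
have leN x : marginal (- x) <= marginal x.
  apply: le_marginal => j; rewrite -(semivalueN hw) -[- (x, j)]/(- x, - j).
  exact: ge_marginal.
split=> // [|x|x y].
- apply/le_anti; rewrite ge0 andbT -(semivalue0 hw); exact: ge_marginal.
- by apply/le_anti; rewrite leN /= -{1}[x]opprK leN.
- (* Bound the two infima of the right-hand side one at a time. *)
  rewrite -lerBlDr; apply: le_marginal => i.
  rewrite lerBlDr -lerBlDl; apply: le_marginal => j; rewrite lerBlDl.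
  exact: le_trans (ge_marginal _ (i + j)) (ler_semivalueD hw (x, i) (y, j)).
Qed.
End marginal.

(** The class of groups with values bounded by 1 is reached by truncation, which
    changes only the distances that exceed the bound. *)
Lemma truncate_semivalue (B : zmodType) (q : B -> R) (c : R) :
  0 <= c -> is_semivalue q -> is_semivalue (fun x => Num.min (q x) c).
Proof.
move=> c0 hq; split=> [x||x|x y].
- by rewrite le_min c0 (semivalue_ge0 hq).
- by rewrite (semivalue0 hq) min_l.
- by rewrite (semivalueN hq).
- have := ler_semivalueD hq x y.
  have := semivalue_ge0 hq x; have := semivalue_ge0 hq y.
  by rewrite !minEle; do !case: ifP; lra.
Qed.

Lemma semivalue_bounded_by (r : \bar R) (B : zmodType) (q : B -> R) :
  r = 1%E \/ r = +oo%E -> is_semivalue q ->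
  exists q' : B -> R,
    [/\ is_semivalue q', forall x, q' x <= q x,
        forall x, ((q' x)%:E <= r)%E
      & forall x, ((q x)%:E <= r)%E -> q' x = q x].
Proof.
case=> -> hq; last by exists q; split=> // x; rewrite leey.
exists (fun x => Num.min (q x) 1); split=> [|x|x|x].
- exact: truncate_semivalue.
- by rewrite ge_min lexx.
- by rewrite lee_fin ge_min lexx orbT.
- by rewrite lee_fin => ?; rewrite min_l.
Qed.

End semivalues.

(** * Finite groups with two torsion generators *)

Lemma mulrz_pair (A B : zmodType) (x : A) (y : B) (n : int) :
  (x, y) *~ n = (x *~ n, y *~ n).
Proof.
by apply: injective_projections; rewrite ?(raddfMz fst) ?(raddfMz snd).
Qed.

Lemma mulrz_modn (A : zmodType) (x : A) (m : nat) (n : int) :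
  (0 < m)%N -> x *+ m = 0 -> x *~ n = x *+ `|(n %% m%:Z)%Z|%N.
Proof.
move=> m0 xm; rewrite {1}(divz_eq n m) mulrzDr mulrC mulrzA -pmulrn xm mul0rz.
by rewrite add0r pmulrn gez0_abs// modz_ge0// -lt0n.
Qed.

Lemma finite_two_generators (A : zmodType) (x y : A) (m n : nat) :
  (0 < m)%N -> x *+ m = 0 -> (0 < n)%N -> y *+ n = 0 ->
  (forall z, exists u v : int, z = x *~ u + y *~ v) -> finite_set [set: A].
Proof.
move=> m0 xm n0 yn gen; pose e (u : 'I_m * 'I_n) := x *+ u.1 + y *+ u.2.
apply: (@sub_finite_set _ _ (range e)); last exact: finite_image.
have lt_mod l (u : int) : (0 < l)%N -> (`|(u %% l%:Z)%Z| < l)%N.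
  by move=> l0; rewrite -ltz_nat gez0_abs ?modz_ge0 ?ltz_pmod// -lt0n.
move=> z _; have [u [v ->]] := gen z.
exists (Ordinal (lt_mod m u m0), Ordinal (lt_mod n v n0)) => //.
by rewrite /e /= -!mulrz_modn.
Qed.

(** * Extending isometries from finite groups *)

Section extension.
Context {R : realType}.

(** Values are bounded by a constant [C], so [pvalue (x *+ n) / n <= C / n]. *)
Lemma finite_class_O0 (F : valuedZmodType R) :
  finite_set [set: F] -> class_O0 F.
Proof.
move=> /finite_seqP[s sE] x.
pose C : R := \sum_(y <- s) pvalue y.
have pC (y : F) : pvalue y <= C.
  have : y \in s by have : [set: F] y by []; rewrite sE.
  move=> /perm_to_rem/(perm_big _) E; rewrite /C E/= big_cons lerDl.
  by apply: sumr_ge0 => z _; exact: pvalue_ge0.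
apply: (@squeeze_cvgr _ _ _ _ (fun=> 0) (fun n : nat => C * n%:R^-1)).
- near=> n; rewrite divr_ge0 ?pvalue_ge0//=.
  by rewrite ler_wpM2r ?invr_ge0.
- exact: cvg_cst.
- rewrite -[X in _ --> X](mulr0 C); apply: cvgM; first exact: cvg_cst.
  rewrite -(@cvg_shiftS R); exact: cvg_harmonic.
Unshelve. all: by end_near. Qed.

Lemma finite_class_G0 (r : \bar R) (F : valuedZmodType R) :
  finite_set [set: F] -> (forall x : F, ((pvalue x)%:E <= r)%E) ->
  class_G0 r F.
Proof.
move=> finF pr; split=> //; last exact: finite_class_O0.
exists setT; first exact: finite_set_countable.
by move=> O [x Ox] _; exists x.
Qed.

(** The extension property of G: an isometric map [j] of A into G extends along
    an isometric map [i] of A into a finite group F of the class.  Universality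
    embeds F into G by some [phi]; homogeneity, applied to the isometry sending
    [phi (i x)] to [j x], corrects [phi] so that it agrees with [j].  That
    isometry is well defined because [i] and [j], which induce the same
    semivalue on A, have the same kernel. *)
Lemma extend_isometry (r : \bar R) (G F : valuedZmodType R) (A : zmodType)
    (i : {additive A -> F}) (j : {additive A -> G}) :
  is_bbG0 r G -> finite_set [set: F] -> class_G0 r F ->
  (forall x, pvalue (i x) = pvalue (j x) :> R) ->
  exists g : {additive F -> G},
    (forall z, pvalue (g z) = pvalue z :> R) /\ forall x, g (i x) = j x.
Proof.
move=> hG finF hF ij.
have [phi [inj_phi phiE]] := bbG0_universal hG finF hF.
pose f (y : G) : G := j (xget 0 [set x | phi (i x) = y]).
have fE x : f (phi (i x)) = j x.
  rewrite /f; case: xgetP => [x' _ /= /inj_phi ix'|/(_ x)]; last by case.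
  apply/subr0_eq/pvalue_eq0; rewrite -raddfB -ij raddfB ix' subrr.
  exact: pvalue0.
have sub_range (h : {additive A -> G}) : is_subgroup (range h).
  split=> [|u v [x _ <-] [y _ <-]]; first by exists 0; rewrite ?raddf0.
  by exists (x - y); rewrite ?raddfB.
have finH : finite_set (range (phi \o i)).
  apply: (@sub_finite_set _ _ (range phi)); last exact: finite_image.
  by move=> _ [x _ <-]; exists (i x).
have finK : finite_set (range j).
  apply: (@sub_finite_set _ _ (f @` range (phi \o i))); last exact: finite_image.
  by move=> _ [x _ <-]; exists (phi (i x)); [exists x|exact: fE].
have [] := bbG0_homogeneous hG (sub_range (phi \o i)) finH (sub_range j) finK
  (f := f).
  split=> [u [x _ <-]|u v [x _ <-] [y _ <-]|u [x _ <-]] /=.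
  - by exists x => //; rewrite fE.
  - by rewrite -(raddfD phi) -(raddfD i) !fE (raddfD j).
  - by rewrite fE phiE ij.
move=> g [g_iso _ gf]; exists (g \o phi); split=> [z|x] /=.
  by rewrite g_iso.
by rewrite gf ?fE//; exists x.
Qed.

End extension.

(** * Adjoining a small root of a torsion element *)

Section adjoin_root.
Context {R : realType} (G : valuedZmodType R).
Variables (a b : G) (k : nat) (delta : R).
Hypotheses (delta0 : 0 < delta) (kb : pvalue b <= delta * k%:R).

(** The point [((m, t), n)] of [Z^2 * Z] stands for the decomposition of
    [m a + t c] into [(m a + n b) + (t - k n) c], where [c] is the root of [b]
    being adjoined, [k c = b]; its cost charges the first summand its value in
    G, and the second one [delta] for each step along [c]. *)
Definition decomposition_cost (u : int * int * int) : R :=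
  pvalue (a *~ u.1.1 + b *~ u.2) + delta * `|(u.1.2 - k%:Z * u.2)%:~R|.

Lemma decomposition_cost_semivalue : is_semivalue decomposition_cost.
Proof.
have d0 := ltW delta0.
split=> [u||u|u v]; rewrite /decomposition_cost.
- by rewrite addr_ge0 ?pvalue_ge0// mulr_ge0.
- by rewrite /= mulr0 subr0 !mulr0z addr0 pvalue0 normr0 mulr0 addr0.
- rewrite /= !mulrNz mulrN -!opprD pvalueN; congr (_ + _ * _).
  by rewrite mulrNz normrN.
- have -> : (u + v).1.2 - k%:Z * (u + v).2
      = (u.1.2 - k%:Z * u.2) + (v.1.2 - k%:Z * v.2).
    by rewrite /= mulrDr opprD addrACA.
  have -> : a *~ (u + v).1.1 + b *~ (u + v).2
      = (a *~ u.1.1 + b *~ u.2) + (a *~ v.1.1 + b *~ v.2).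
    by rewrite /= !mulrzDr addrACA.
  rewrite [X in _ <= X]addrACA lerD ?ler_pvalueD//.
  by rewrite -mulrDr ler_wpM2l// rmorphD ler_normD.
Qed.

(** The value that [m a + t c] is to receive. *)
Definition root_semivalue : int * int -> R := marginal decomposition_cost.

Lemma root_semivalueP : is_semivalue root_semivalue.
Proof. exact: marginal_semivalue decomposition_cost_semivalue. Qed.

(** The new value extends that of [<a, b>]: replacing part of [b] by multiples
    of [c] saves nothing, because [k] steps along [c] cost at least [pvalue b]. *)
Lemma root_semivalue_mul m n :
  root_semivalue (m, k%:Z * n) = pvalue (a *~ m + b *~ n).
Proof.
apply/le_anti/andP; split.
  apply: le_trans (ge_marginal decomposition_cost_semivalue _ n) _.
  by rewrite /decomposition_cost /= subrr normr0 mulr0 addr0.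
apply: le_marginal => j; rewrite /decomposition_cost /= -mulrBr.
have -> : a *~ m + b *~ n = a *~ m + b *~ j + b *~ (n - j).
  by rewrite -addrA -mulrzDr addrC subrKC addrC.
apply: le_trans (ler_pvalueD _ _) _; rewrite lerD2l.
apply: le_trans (pvalue_mulrz _ _) _.
by rewrite intrM normrM mulrA normr_nat ler_wpM2r.
Qed.

Lemma root_semivalue_root : root_semivalue (0, 1) <= delta.
Proof.
apply: le_trans (ge_marginal decomposition_cost_semivalue _ 0) _.
rewrite /decomposition_cost /= mulr0 subr0 !mulr0z addr0 pvalue0 normr1.
by rewrite mulr1 add0r.
Qed.

End adjoin_root.

(** The element found is [x = a + c], where [k c = b] for a multiple [k] of the
    order of [a]: multiplying [x] by [k] kills [a] and turns [c] into [b]. *)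
Lemma torsion_approx (R : realType) (r : \bar R) (G : valuedZmodType R) (a b : G)
    (m n : nat) (delta : R) :
  r = 1%E \/ r = +oo%E -> is_bbG0 r G ->
  (0 < m)%N -> a *+ m = 0 -> (0 < n)%N -> b *+ n = 0 -> 0 < delta ->
  exists (x : G) (k : int), pvalue (x - a) <= delta /\ x *~ k = b.
Proof.
move=> hr hG m0 am n0 bn delta0.
pose M := (m * n)%N; have M0 : (0 < M)%N by rewrite muln_gt0 m0.
have aM : a *+ M = 0 by rewrite mulrnA am mul0rn.
have bM : b *+ M = 0 by rewrite /M mulnC mulrnA bn mul0rn.
have aMz z : a *~ (M%:Z * z) = 0 by rewrite mulrzA -pmulrn aM mul0rz.
have bMz z : b *~ (M%:Z * z) = 0 by rewrite mulrzA -pmulrn bM mul0rz.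
have [s s0 sb] : exists2 s : nat, (0 < s)%N & pvalue b <= delta * s%:R.
  exists (Num.bound (pvalue b / delta)).+1 => //.
  rewrite mulrC -ler_pdivrMr// (le_trans (ltW (archi_boundP _)))//.
    by rewrite divr_ge0 ?pvalue_ge0// ltW.
  by rewrite ler_nat.
(* k is a multiple of M to kill a, and large enough for c to be short. *)
pose k := (M * s)%N; have k0 : (0 < k)%N by rewrite muln_gt0 M0.
have kb : pvalue b <= delta * k%:R.
  apply: (le_trans sb); rewrite ler_pM2l// ler_nat /k.
  by rewrite leq_pmull.
pose q := root_semivalue a b k delta.
have hq : is_semivalue q by exact: root_semivalueP.
have [q' [hq' q'q q'r q'E]] := semivalue_bounded_by hr hq.
have [F [pi [surj piE]]] := valued_quotient hq'.
have [_ _ pr] := bbG0_class hG.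
have q'kE u v : q' (u, k%:Z * v) = pvalue (a *~ u + b *~ v).
  by rewrite q'E /q root_semivalue_mul.
have finF : finite_set [set: F].
  apply: (@finite_two_generators _ (pi (1, 0)) (pi (0, 1)) M (k * M)) => //.
  - apply/(pvalue_eq0 (s := F)); rewrite pmulrn -raddfMz piE mulrz_pair mul0rz.
    by rewrite intz -(mulr0 k%:Z) q'kE -pmulrn aM add0r pvalue0.
  - by rewrite muln_gt0 k0.
  - apply/(pvalue_eq0 (s := F)); rewrite pmulrn -raddfMz piE mulrz_pair mul0rz.
    by rewrite intz PoszM q'kE -pmulrn bM add0r pvalue0.
  - move=> z; have [[u v] <-] := surj z; exists u, v.
    rewrite -!raddfMz -raddfD !mulrz_pair !intz !mul0rz.
    by congr (pi (_, _)); rewrite /= ?addr0 ?add0r.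
have hF : class_G0 r F.
  by apply: finite_class_G0 => // z; have [x <-] := surj z; rewrite piE.
(* F is generated by pi (1, 0), in the role of a, and pi (0, 1), in that of c;
   i and j send (m, n) to m a + n b, computed in F as m a + (k n) c. *)
pose i u : F := pi (u.1, k%:Z * u.2).
pose j u : G := a *~ u.1 + b *~ u.2.
have iA : additive i.
  by move=> u v; rewrite /i -raddfB /= mulrBr.
have jA : additive j.
  by move=> u v; rewrite /j /= !mulrzBr opprD addrACA.
pose iL : {additive int * int -> F} :=
  HB.pack i (GRing.isZmodMorphism.Build _ _ i iA).
pose jL : {additive int * int -> G} :=
  HB.pack j (GRing.isZmodMorphism.Build _ _ j jA).
have [u|g [g_iso gE]] := @extend_isometry R r G F _ iL jL hG finF hF.
  by rewrite /= /i /j piE q'kE.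
exists (g (pi (1, 1))), k; split.
  have -> : a = g (pi (1, 0)).
    have := gE (1, 0); rewrite /= /i /j /= mulr0 mulr1z mulr0z addr0 => <-.
    by [].
  rewrite -!raddfB g_iso piE.
  exact: le_trans (q'q _) (root_semivalue_root a b k delta0).
rewrite -!raddfMz.
have -> : (1, 1) *~ k = (M%:Z * s%:Z, k%:Z * 1) :> (int * int)%type.
  by rewrite mulrz_pair !intz mulr1.
have := gE (M%:Z * s%:Z, 1); rewrite /= /i /j /= => ->.
by rewrite aMz add0r.
Qed.

(** * Topology of valued groups and Baire category *)

Lemma dense_closure (T : topologicalType) (S : set T) :
  dense S -> closure S = setT.
Proof.
move=> dS; apply/seteqP; split=> // x _ B; rewrite nbhsE => -[U [oU Ux] UB].
by have [y [Uy Sy]] := dS U (ex_intro _ x Ux) oU; exists y; split=> //; exact: UB.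
Qed.

Lemma nowhere_denseC (T : topologicalType) (U : set T) :
  open U -> closure U = setT -> nowhere_dense (~` U).
Proof.
move=> oU dU; rewrite /nowhere_dense closure_setC (interior_id U).1//.
by rewrite interiorC dU setCT.
Qed.

Lemma meager_bigcup (T : topologicalType) (I : countType) (F : I -> set T) :
  (forall i, nowhere_dense (F i)) -> meager (\bigcup_i F i).
Proof.
move=> Fnd; exists (fun n => if unpickle n is Some i then F i else set0).
  by move=> n; case: unpickle => // ; rewrite /nowhere_dense closure0 interior0.
apply/seteqP; split=> [x [i _ Fix]|x [n _]].
  by exists (pickle i) => //; rewrite pickleK.
by case: unpickle => // i Fix; exists i.
Qed.

Section topology.
Context {R : realType} (G : valuedZmodType R).
Implicit Types (x d : G) (A : set G) (e : R).

Lemma closure_pvalueP A x :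
  closure A x <-> forall e, 0 < e -> exists2 y, A y & pvalue (x - y) < e.
Proof.
split=> [clx e e0|cl B /(nbhs_ballP (R := R))[e /= e0 eB]].
  have [y [Ay xy]] := clx _ (nbhsx_ballx x e e0).
  by exists y => //; move: xy; rewrite ballEmdist.
have [y Ay xy] := cl _ e0; exists y; split=> //; apply: eB.
by rewrite ballEmdist.
Qed.

Definition near_multiples d e : set G :=
  [set x | exists k : int, pvalue (d - x *~ k) < e].

Lemma open_near_multiples d e : open (near_multiples d e).
Proof.
rewrite openE => x [k xk].
(* Multiplication by k is Lipschitz with constant |k|; N avoids dividing by 0. *)
apply/(@nbhs_ballP R).
pose N : R := `|k%:~R| + 1; have N0 : 0 < N by rewrite ltr_wpDl.
exists ((e - pvalue (d - x *~ k)) / N) => /=; first by rewrite divr_gt0 ?subr_gt0.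
move=> y; rewrite ballEmdist /= => xy; exists k.
have -> : d - y *~ k = (d - x *~ k) + (x - y) *~ k.
  by rewrite mulrzBl addrA subrK.
apply: le_lt_trans (ler_pvalueD _ _) _; rewrite -ltrBrDl.
apply: le_lt_trans (pvalue_mulrz _ _) _.
rewrite (@le_lt_trans _ _ (pvalue (x - y) * N))//; last by rewrite -ltr_pdivlMr.
by rewrite ler_wpM2l ?pvalue_ge0// lerDl.
Qed.

Lemma Gen_near_multiples (f : nat -> G) : closure (range f) = setT ->
  Gen G = \bigcap_(ij : nat * nat) near_multiples (f ij.1) ij.2.+1%:R^-1.
Proof.
move=> fdense; apply/seteqP; split=> [x xgen [i j] _|x xf].
  have : closure (cyclic_subgroup x) (f i) by rewrite [closure _]xgen.
  by move=> /closure_pvalueP/(_ j.+1%:R^-1)[//|_ [k _ <-]]; exists k.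
apply/seteqP; split=> // y _; apply/closure_pvalueP => e e0.
have e2 : 0 < e / 2 by rewrite divr_gt0.
have /closure_pvalueP/(_ _ e2)[_ [i _ <-] yi] : closure (range f) y.
  by rewrite fdense.
have [j je] : exists j : nat, j.+1%:R^-1 < e / 2.
  exists (Num.bound (e / 2)^-1).
  rewrite invf_plt ?posrE// (lt_le_trans (archi_boundP _))//.
    by rewrite invr_ge0 ltW.
  by rewrite ler_nat.
have [k ik] := xf (i, j) I; exists (x *~ k); first by exists k.
rewrite -[y](subrK (f i)) -addrA (le_lt_trans (ler_pvalueD _ _))//.
by rewrite [e]splitr ltrD// (lt_trans ik).
Qed.

(** Approximate the given point and [d] by torsion elements, and move the former
    slightly so that the latter becomes one of its multiples. *)
Lemma dense_near_multiples (r : \bar R) d e :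
  r = 1%E \/ r = +oo%E -> is_bbG0 r G -> 0 < e ->
  closure (near_multiples d e) = setT.
Proof.
move=> hr hG e0; apply/seteqP; split=> // x _; apply/closure_pvalueP => c c0.
have tor z : forall t, 0 < t ->
    exists2 a : G, (exists2 n, (0 < n)%N & a *+ n = 0) & pvalue (z - a) < t.
  by apply/(closure_pvalueP [set a | _]);
    rewrite (dense_closure (bbG0_torsion_dense hG)).
have [a [m m0 am] xa] := tor x _ (divr_gt0 c0 (ltr0Sn R 1)).
have [b [n n0 bn] db] := tor d _ e0.
have [y [k [ya yk]]] :=
  torsion_approx hr hG m0 am n0 bn (divr_gt0 c0 (ltr0Sn R 1)).
exists y; first by exists k; rewrite yk.
rewrite -[x](subrK a) -addrA (le_lt_trans (ler_pvalueD _ _))//.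
by rewrite [c]splitr ltr_leD// -pvalueN opprB.
Qed.

Lemma countable_dense_sequence : separable G ->
  exists f : nat -> G, closure (range f) = setT.
Proof.
move=> [D /pfcard_geP [D0|[f]] dD].
  have [|//|x []] := dD setT; first by exists 0.
  - exact: openT.
  by rewrite D0.
exists f; rewrite -(dense_closure dD); congr closure.
apply/seteqP; split=> [_ [n _ <-]|x]; first exact: funS.
exact: (@surj _ _ _ _ f).
Qed.

End topology.

Theorem theorem5p3 (R : realType) (r : \bar R)
  (hr : r = 1%E \/ r = +oo%E)
  (G : valuedZmodType R) (hG : is_bbG0 r G) :
  comeager (Gen G).
Proof.
have [sepG _ _] := bbG0_class hG.
have [f fdense] := countable_dense_sequence sepG.
rewrite /comeager (Gen_near_multiples fdense) setC_bigcap.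
apply: meager_bigcup => ij; apply: nowhere_denseC.
  exact: open_near_multiples.
exact: (dense_near_multiples _ hr hG).
Qed.
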